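(* Let $\{Z_t\}_{t=0,1,2,\dots}$ be a Parisian walk and let $f:\mathbb{Z}[\zeta]\to\mathbb{C}$ be a function. Then for every $t=0,1,2,\dots$, $$\begin{aligned} f(Z_{t+1})-f(Z_t) &= \tfrac13 (Z_{t+1}-Z_t)\{ f(Z_t+1)+\zeta^2 f(Z_t+\zeta)+\zeta f(Z_t+\zeta^2)\}\\ &\quad+\tfrac13(\bar Z_{t+1}-\bar Z_t)\{ f(Z_t+1)+\zeta f(Z_t+\zeta)+\zeta^2 f(Z_t+\zeta^2)\}\\ &\quad+\tfrac13\{ f(Z_t+1)+f(Z_t+\zeta)+f(Z_t+\zeta^2)-3f(Z_t)\}.\end{aligned}$$
   Context: Let $\zeta=(-1+\sqrt{-3})/2$ and $\mathbb{Z}[\zeta]=\{a+b\zeta : a,b\in\mathbb{Z}\}\subset\mathbb{C}$. Let $\tau_1,\tau_2,\dots$ be an i.i.d. sequence with $\mathsf{P}(\tau_i=1)=\mathsf{P}(\tau_i=\zeta)=\mathsf{P}(\tau_i=\zeta^2)=1/3$, and let $\mathbf{F}=\{\mathcal{F}_t\}_{t\ge 0}$ be the filtration it generates: $\mathcal{F}_t=\sigma(\tau_1,\dots,\tau_t)$, with $\mathcal{F}_0$ trivial. Parisian walk: an $\mathbf{F}$-adapted complex valued process $\{Z_t\}_{t\ge 0}$ such that (i) it is an $\mathbf{F}$-martingale starting from a point of $\mathbb{Z}[\zeta]$, and (ii) $Z_{t+1}-Z_t\in\{1,\zeta,\zeta^2\}$ for all $t$. A bar over $Z$ denotes complex conjugation.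 *)

(* Defs.v *)
From HB Require Import structures.
From mathcomp Require Import all_boot all_order all_algebra.
From mathcomp Require Import all_classical all_reals all_analysis.
From mathcomp Require Import ring.
From mathcomp Require Export complex.

Set Implicit Arguments.
Unset Strict Implicit.
Unset Printing Implicit Defensive.

Import Order.TTheory GRing.Theory Num.Theory.

Local Open Scope classical_set_scope.
Local Open Scope ring_scope.

Section Eisenstein.
Variable R : realType.

(* [sqrtC] is the square root with nonnegative imaginary part. *)
Definition zeta : R[i] := (-1 + sqrtC (-3)) / 2.

Definition Zzeta_pred : {pred R[i]} :=
  fun z => `[< exists a b : int, z = a%:~R + b%:~R * zeta >].

Lemma zeta_sqr : zeta ^+ 2 = -1 - zeta.
Proof.
rewrite /zeta expr_div_n sqrrD sqrtCK.
by field.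
Qed.

Lemma ZzetaP z :
  reflect (exists a b : int, z = a%:~R + b%:~R * zeta) (z \in Zzeta_pred).
Proof. exact: asboolP. Qed.

Lemma Zzeta_subring : subring_closed Zzeta_pred.
Proof.
split.
- by apply/ZzetaP; exists 1, 0; rewrite mul0r addr0.
- move=> x y /ZzetaP[a [b ->]] /ZzetaP[c [e ->]]; apply/ZzetaP.
  by exists (a - c), (b - e); rewrite !rmorphB /=; ring.
- move=> x y /ZzetaP[a [b ->]] /ZzetaP[c [e ->]]; apply/ZzetaP.
  exists (a * c - b * e), (a * e + b * c - b * e).
  rewrite !(rmorphB, rmorphD, rmorphM) /=.
  have h := zeta_sqr.
  transitivity (a%:~R * c%:~R + (a%:~R * e%:~R + b%:~R * c%:~R) * zeta
                + b%:~R * e%:~R * zeta ^+ 2); first by ring.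
  by rewrite h; ring.
Qed.

HB.instance Definition _ :=
  GRing.isSubringClosed.Build R[i] Zzeta_pred Zzeta_subring.

Record Zzeta := MkZzeta { Zzeta_val :> R[i]; _ : Zzeta_val \in Zzeta_pred }.

HB.instance Definition _ := [isSub for Zzeta_val].
HB.instance Definition _ := [Choice of Zzeta by <:].
HB.instance Definition _ := [SubChoice_isSubComNzRing of Zzeta by <:].

Lemma zeta_subproof : zeta \in Zzeta_pred.
Proof. by apply/ZzetaP; exists 0, 1; rewrite mul1r add0r. Qed.

Definition zetaZ : Zzeta := MkZzeta zeta_subproof.

End Eisenstein.

Section ComplexProcesses.
Context (R : realType) (d : measure_display) (Omega : measurableType d).
Variable P : probability Omega R.

Definition ReIm (z : R[i]) : R * R := (complex.Re z, complex.Im z).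

(* C carries the Borel sigma-algebra of R x R, through [ReIm]. *)
Definition sigma_of (X : Omega -> R[i]) : set (set Omega) :=
  preimage_set_system setT (ReIm \o X) measurable.

Definition cmeasurable (G : set (set Omega)) (X : Omega -> R[i]) : Prop :=
  sigma_of X `<=` G.

Definition cintegrable (X : Omega -> R[i]) : Prop :=
  P.-integrable setT (EFin \o (fun w => complex.Re (X w))) /\
  P.-integrable setT (EFin \o (fun w => complex.Im (X w))).

Definition cintegral (A : set Omega) (X : Omega -> R[i]) : R[i] :=
  Complex (Rintegral P A (fun w => complex.Re (X w)))
          (Rintegral P A (fun w => complex.Im (X w))).

(* [Y] is a version of E[X | G], hence equality is up to a null set. *)
Definition is_cond_exp (G : set (set Omega)) (X Y : Omega -> R[i]) : Prop :=
  [/\ cmeasurable G Y, cintegrable Y &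
      forall A, G A -> cintegral A Y = cintegral A X].

Definition adapted (F : nat -> set (set Omega)) (Z : nat -> Omega -> R[i]) :=
  forall t, cmeasurable (F t) (Z t).

Definition martingale (F : nat -> set (set Omega)) (Z : nat -> Omega -> R[i]) :=
  [/\ adapted F Z, forall t, cintegrable (Z t) &
      forall t, is_cond_exp (F t) (Z t.+1) (Z t)].

Definition mutually_independent (X : nat -> Omega -> R[i]) : Prop :=
  forall (s : seq nat) (A : nat -> set Omega), uniq s ->
    (forall i, i \in s -> sigma_of (X i) (A i)) ->
    P (\big[setI/setT]_(i <- s) A i) = (\prod_(i <- s) P (A i))%E.

(* Sequences are indexed from 0: [tau i] is the (i+1)-st variable. *)
Record iid_uniform (tau : nat -> Omega -> R[i]) : Prop := IidUniform {
  iid_measurable : forall i, cmeasurable measurable (tau i);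
  iid_independent : mutually_independent tau;
  iid_law : forall i, [/\ P [set w | tau i w = 1] = (3^-1)%:E,
                          P [set w | tau i w = zeta R] = (3^-1)%:E &
                          P [set w | tau i w = zeta R ^+ 2] = (3^-1)%:E] }.

(* Generated by the first [t] variables, hence trivial for t = 0. *)
Definition natural_filtration (tau : nat -> Omega -> R[i]) (t : nat) :
    set (set Omega) :=
  <<s \bigcup_(i in [set i | (i < t)%N]) sigma_of (tau i) >>.

Record parisian_walk (F : nat -> set (set Omega)) (Z : nat -> Omega -> R[i]) :
    Prop := ParisianWalk {
  walk_adapted : adapted F Z;
  walk_martingale : martingale F Z;
  walk_start : exists z0 : Zzeta R, forall w, Z 0 w = z0;
  walk_step : forall t w,
    Z t.+1 w - Z t w \in [:: 1; zeta R; zeta R ^+ 2] }.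

Lemma walk_in_Zzeta F Z : parisian_walk F Z ->
  forall t w, Z t w \in @Zzeta_pred R.
Proof.
move=> hZ; elim=> [|t IH] w.
  by have [z0 ->] := walk_start hZ; exact: valP.
rewrite -(subrK (Z t w) (Z t.+1 w)); apply: rpredD; last exact: IH.
have := walk_step hZ t w.
rewrite !in_cons in_nil orbF => /or3P[] /eqP ->.
- exact: rpred1.
- exact: zeta_subproof.
- by apply: rpredX; exact: zeta_subproof.
Qed.

Definition walk_pos F Z (hZ : parisian_walk F Z) (t : nat) (w : Omega) :
    Zzeta R :=
  MkZzeta (walk_in_Zzeta hZ t w).

End ComplexProcesses.

(* Main.v *)
(* The identity is Fourier inversion on Z/3: the increment is a cube root of
   unity, its conjugate is its square, and [1 + zeta + zeta ^+ 2 = 0] makes the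
   right-hand side select the value of [f] at the neighbour that is reached. *)
Require Import Defs.
From HB Require Import structures.
From mathcomp Require Import all_boot all_order all_algebra.
From mathcomp Require Import all_classical all_reals all_analysis.
From mathcomp Require Import ring.
From mathcomp Require Import complex.

Set Implicit Arguments.
Unset Strict Implicit.
Unset Printing Implicit Defensive.

Import Order.TTheory GRing.Theory Num.Theory.

Local Open Scope ring_scope.

Lemma zeta_cube (R : realType) : zeta R ^+ 3 = 1.
Proof.
have h := zeta_sqr R.
by rewrite exprS h mulrBr -expr2 h; ring.
Qed.

(** A root of unity has modulus 1, so its conjugate is its inverse, and the inverse of a cube root
    of unity is its square. *)
Lemma conj_zeta (R : realType) : (zeta R)^* = zeta R ^+ 2.
Proof.
have norm1 : `|zeta R| = 1.
  (* A nonnegative real whose cube is 1 equals 1. *)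
  apply/eqP; rewrite -(@pexpr_eq1 _ _ 3) // -normrX zeta_cube.
  by rewrite normr1.
have conjK : zeta R * (zeta R)^* = 1 by rewrite -normCK norm1 expr1n.
by rewrite -[LHS]mul1r -(zeta_cube R) exprSr -mulrA conjK mulr1.
Qed.

Theorem proposition1 (R : realType) (d : measure_display)
    (Omega : measurableType d) (P : probability Omega R)
    (tau : nat -> Omega -> R[i]) (htau : iid_uniform P tau)
    (Z : nat -> Omega -> R[i])
    (hZ : parisian_walk P (natural_filtration tau) Z)
    (f : Zzeta R -> R[i]) (t : nat) (w : Omega) :
  let z := zeta R in
  let zZ := zetaZ R in
  let pos := walk_pos hZ in
  f (pos t.+1 w) - f (pos t w) =
      3^-1 * (Z t.+1 w - Z t w) *
        (f (pos t w + 1) + z ^+ 2 * f (pos t w + zZ)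
         + z * f (pos t w + zZ ^+ 2))
    + 3^-1 * ((Z t.+1 w)^* - (Z t w)^*) *
        (f (pos t w + 1) + z * f (pos t w + zZ)
         + z ^+ 2 * f (pos t w + zZ ^+ 2))
    + 3^-1 * (f (pos t w + 1) + f (pos t w + zZ) + f (pos t w + zZ ^+ 2)
              - 3 * f (pos t w)).
Proof.
move=> z zZ pos.
have z2 : z ^+ 2 = -1 - z := zeta_sqr R.
(* [f] takes arguments in the subring [Zzeta], so the increment known in [R[i]] is lifted there by
   injectivity of [val]. *)
have step x : Z t.+1 w - Z t w = Zzeta_val x -> pos t.+1 w = pos t w + x.
  by move=> e; apply: val_inj; rewrite rmorphD /= -e addrC subrK.
(* The difference of conjugates becomes the conjugate of the increment, which [e] then makes
   explicit. *)
rewrite -rmorphB /=.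
have := walk_step hZ t w; rewrite !in_cons in_nil orbF => /or3P[] /eqP e.
- rewrite (step 1) // e rmorph1.
  by field: z2.
- rewrite (step zZ) // e conj_zeta -/z z2.
  by field: z2.
(* Here the conjugate appears as [(z ^+ 2) ^+ 2], which reduces to [z] modulo [z2]. *)
- rewrite (step (zZ ^+ 2)) // e rmorphXn /= conj_zeta -/z.
  by field: z2.
Qed.
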